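(* Let $X, Y$ be unital regular poly-bicategories, and $f: X \to Y$ a tensor strong morphism. Then $f$ maps tensor units in $X$ to tensor units in $Y$.
   Context: A regular 2-polygraph $X$ consists of a set of 0-cells, a set of 1-cells $a: x \to y$ (each with a source and a target 0-cell), and, for all $n,m\ge 1$, a set of 2-cells $p:(a_1,\ldots,a_n)\to(b_1,\ldots,b_m)$, whose input $(a_i)$ and output $(b_j)$ are non-empty composable sequences of 1-cells (the target of each is the source of the next) with the same initial source and the same final target; write $\partial_i^-p=a_i$, $\partial_j^+p=b_j$. Greek capitals denote possibly empty composable sequences of 1-cells, and commas denote concatenation. A (non-unital) regular poly-bicategory is a regular 2-polygraph with operations $\mathrm{cut}_{j,i}$: given $t:(\Gamma)\to(\Delta_1,a,\Delta_2)$ and $s:(\Gamma_1,a,\Gamma_2)\to(\Delta)$, where the displayed $a$ is the $j$-th output of $t$ and the $i$-th input of $s$, such that ($\Gamma_1$ or $\Delta_1$ is empty) and ($\Gamma_2$ or $\Delta_2$ is empty), there is a composite 2-cell $\mathrm{cut}_{j,i}(t,s):(\Gamma_1,\Gamma,\Gamma_2)\to(\Delta_1,\Delta,\Delta_2)$. These satisfy associativity and interchange: whenever three 2-cells can be composed by two cuts, along the same two identified 1-cells, in two different orders, the two results are equal (e.g. $\mathrm{cut}_{j,1}(t,\mathrm{cut}_{i,1}(s,r))=\mathrm{cut}_{i+j-1,1}(\mathrm{cut}_{j,1}(t,s),r)$). No unit cells are part of the structure. A morphism is a map of 0-, 1- and 2-cells preserving all boundaries and all cut operations. Universality. A 2-cell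 $t:(\Gamma)\to(\Delta_1,a,\Delta_2)$, with $a$ in $j$-th position, is universal at $\partial_j^+$ if for all $\Gamma_1,\Gamma_2$ and non-empty $\Delta$ with ($\Gamma_1$ or $\Delta_1$ empty) and ($\Gamma_2$ or $\Delta_2$ empty), every 2-cell $s:(\Gamma_1,\Gamma,\Gamma_2)\to(\Delta_1,\Delta,\Delta_2)$ equals $\mathrm{cut}(t,r)$, composed along $a$, for a unique $r:(\Gamma_1,a,\Gamma_2)\to(\Delta)$. Dually, $t:(\Gamma_1,a,\Gamma_2)\to(\Delta)$, with $a$ in $i$-th position, is universal at $\partial_i^-$ if for all $\Delta_1,\Delta_2$ and non-empty $\Gamma$ with ($\Gamma_1$ or $\Delta_1$ empty) and ($\Gamma_2$ or $\Delta_2$ empty), every $s:(\Gamma_1,\Gamma,\Gamma_2)\to(\Delta_1,\Delta,\Delta_2)$ equals $\mathrm{cut}(r,t)$, composed along $a$, for a unique $r:(\Gamma)\to(\Delta_1,a,\Delta_2)$. A unit on a 1-cell $a$ is a 2-cell $\mathrm{id}_a:(a)\to(a)$ such that every cut with $\mathrm{id}_a$, on either side, returns the other 2-cell. $X$ is unital if every 1-cell has a unit. A morphism of unital regular poly-bicategories is unital if it maps units (on 1-cells) to units. A tensor of 1-cells $a: x\to y$, $b: y\to z$ is a 2-cell $(a,b)\to(c)$ universal at $\partial_1^+$. Tensor units. A 1-cell $1_x: x\to x$ is a tensor unit on $x$ if for each 1-cell $a: x\to y$ there is a 2-cell $l_a:(1_x,a)\to(a)$ universal at both $\partial_1^+$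 and $\partial_2^-$, and for each 1-cell $b:z\to x$ there is a 2-cell $r_b:(b,1_x)\to(b)$ universal at both $\partial_1^+$ and $\partial_1^-$. Tensor universality. Let $e: x \to x'$ be a 1-cell. It is tensor left universal if for each 1-cell $a: x\to y$ there exist a 1-cell $u: x'\to y$ and a 2-cell $(e,u)\to(a)$ universal at both $\partial_1^+$ and $\partial_2^-$, and for each 1-cell $a':x'\to y$ there exist a 1-cell $v: x\to y$ and a 2-cell $(e,a')\to(v)$ universal at both $\partial_1^+$ and $\partial_2^-$. It is tensor right universal if for each $b': z\to x'$ there exist $u: z\to x$ and a 2-cell $(u,e)\to(b')$ universal at both $\partial_1^+$ and $\partial_1^-$, and for each $b:z\to x$ there exist $v: z\to x'$ and a 2-cell $(b,e)\to(v)$ universal at both $\partial_1^+$ and $\partial_1^-$. It is tensor universal if it is both tensor left and tensor right universal. A morphism $f: X\to Y$ of unital regular poly-bicategories is tensor strong if it is unital, maps tensor universal 1-cells to tensor universal 1-cells, and preserves tensors (maps each 2-cell $(a,b)\to(c)$ universal at $\partial_1^+$ to a 2-cell universal at $\partial_1^+$). *)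

(* Defs.v *)
From mathcomp Require Import all_boot.

Set Implicit Arguments.
Unset Strict Implicit.
Unset Printing Implicit Defensive.

(* [is_path src tgt x s y]: the sequence [s] is composable, starts at [x] and
   ends at [y]. *)
Fixpoint is_path (C0 C1 : Type) (src tgt : C1 -> C0)
    (x : C0) (s : seq C1) (y : C0) : Prop :=
  if s is a :: s' then src a = x /\ is_path src tgt (tgt a) s' y else x = y.

(* The family of sets of 2-cells indexed by their boundaries is encoded as one
   type [cell2] with two boundary maps, so that cells whose boundaries are only
   propositionally equal can be compared without transport. *)
Record polygraph2 : Type := Polygraph2 {
  cell0 : Type;
  cell1 : Type;
  cell2 : Type;
  src : cell1 -> cell0;
  tgt : cell1 -> cell0;
  inp : cell2 -> seq cell1;
  outp : cell2 -> seq cell1;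
  inp_neq0 : forall t, inp t <> [::];
  outp_neq0 : forall t, outp t <> [::];
  boundary_path : forall t, exists x y,
    is_path src tgt x (inp t) y /\ is_path src tgt x (outp t) y
}.

Definition hom1 (X : polygraph2) (x y : cell0 X) (a : cell1 X) : Prop :=
  src a = x /\ tgt a = y.

Definition hom2 (X : polygraph2) (G D : seq (cell1 X)) (t : cell2 X) : Prop :=
  inp t = G /\ outp t = D.

(* The side condition of a cut, where G1, G2 surround the 1-cell in the input
   of one cell, and D1, D2 surround it in the output of the other. *)
Definition planar (T : Type) (G1 G2 D1 D2 : seq T) : Prop :=
  (G1 = [::] \/ D1 = [::]) /\ (G2 = [::] \/ D2 = [::]).

(* Here and below, positions in boundaries are counted from 0. *)
Definition cuttable (X : polygraph2) (j i : nat) (t s : cell2 X) : Prop :=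
  exists (D1 D2 G1 G2 : seq (cell1 X)) (a : cell1 X),
    [/\ outp t = D1 ++ a :: D2, size D1 = j,
        inp s = G1 ++ a :: G2, size G1 = i & planar G1 G2 D1 D2].

(* [cut j i t s] is meaningful only when [cuttable j i t s]; its other values
   are junk, constrained by no axiom.  The three possible configurations of
   three cells joined along two 1-cells are:
   - [cut_chain]: an output of t is an input of s, an output of s is an input
     of r;
   - [cut_fork]: two outputs of t, at positions j < l, are inputs of s and r;
   - [cut_join]: two inputs of r, at positions i < k, are outputs of t and s. *)
Record polybicat : Type := Polybicat {
  polybicat_polygraph :> polygraph2;
  cut : nat -> nat -> cell2 polybicat_polygraph -> cell2 polybicat_polygraph ->
        cell2 polybicat_polygraph;
  cut_boundary : forall (t s : cell2 polybicat_polygraph)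
      (D1 D2 G1 G2 : seq (cell1 polybicat_polygraph)) a,
    outp t = D1 ++ a :: D2 -> inp s = G1 ++ a :: G2 -> planar G1 G2 D1 D2 ->
    hom2 (G1 ++ inp t ++ G2) (D1 ++ outp s ++ D2)
      (cut (size D1) (size G1) t s);
  cut_chain : forall (t s r : cell2 polybicat_polygraph) (j i l k : nat),
    cuttable j i t s -> cuttable (j + l) k (cut j i t s) r ->
    cuttable l k s r -> cuttable j (k + i) t (cut l k s r) ->
    cut j (k + i) t (cut l k s r) = cut (j + l) k (cut j i t s) r;
  cut_fork : forall (t s r : cell2 polybicat_polygraph) (j i l k : nat),
    j < l ->
    cuttable j i t s -> cuttable (l.-1 + size (outp s)) k (cut j i t s) r ->
    cuttable l k t r -> cuttable j i (cut l k t r) s ->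
    cut (l.-1 + size (outp s)) k (cut j i t s) r = cut j i (cut l k t r) s;
  cut_join : forall (t s r : cell2 polybicat_polygraph) (j i l k : nat),
    i < k ->
    cuttable j i t r -> cuttable l (k.-1 + size (inp t)) s (cut j i t r) ->
    cuttable l k s r -> cuttable j i t (cut l k s r) ->
    cut l (k.-1 + size (inp t)) s (cut j i t r) = cut j i t (cut l k s r)
}.

Record morphism (X Y : polybicat) : Type := Morphism {
  map0 : cell0 X -> cell0 Y;
  map1 : cell1 X -> cell1 Y;
  map2 : cell2 X -> cell2 Y;
  map_src : forall a, src (map1 a) = map0 (src a);
  map_tgt : forall a, tgt (map1 a) = map0 (tgt a);
  map_inp : forall t, inp (map2 t) = map map1 (inp t);
  map_outp : forall t, outp (map2 t) = map map1 (outp t);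
  map_cut : forall (j i : nat) (t s : cell2 X), cuttable j i t s ->
    map2 (cut j i t s) = cut j i (map2 t) (map2 s)
}.

Definition universal_out (X : polybicat) (j : nat) (t : cell2 X) : Prop :=
  exists (D1 D2 : seq (cell1 X)) (a : cell1 X),
    [/\ outp t = D1 ++ a :: D2, size D1 = j &
        forall (G1 G2 D : seq (cell1 X)) (s : cell2 X),
          D <> [::] -> planar G1 G2 D1 D2 ->
          hom2 (G1 ++ inp t ++ G2) (D1 ++ D ++ D2) s ->
          exists! r : cell2 X,
            hom2 (G1 ++ a :: G2) D r /\ s = cut j (size G1) t r].

Definition universal_in (X : polybicat) (i : nat) (t : cell2 X) : Prop :=
  exists (G1 G2 : seq (cell1 X)) (a : cell1 X),
    [/\ inp t = G1 ++ a :: G2, size G1 = i &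
        forall (D1 D2 G : seq (cell1 X)) (s : cell2 X),
          G <> [::] -> planar G1 G2 D1 D2 ->
          hom2 (G1 ++ G ++ G2) (D1 ++ outp t ++ D2) s ->
          exists! r : cell2 X,
            hom2 G (D1 ++ a :: D2) r /\ s = cut (size D1) i r t].

Definition is_unit (X : polybicat) (a : cell1 X) (u : cell2 X) : Prop :=
  [/\ hom2 [:: a] [:: a] u,
      forall (j : nat) (t : cell2 X), cuttable j 0 t u -> cut j 0 t u = t &
      forall (i : nat) (t : cell2 X), cuttable 0 i u t -> cut 0 i u t = t].

Definition unital (X : polybicat) : Prop :=
  forall a : cell1 X, exists u : cell2 X, is_unit a u.

Definition unital_morphism (X Y : polybicat) (f : morphism X Y) : Prop :=
  forall (a : cell1 X) (u : cell2 X), is_unit a u ->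
    is_unit (map1 f a) (map2 f u).

Definition is_tensor (X : polybicat) (a b c : cell1 X) (t : cell2 X) : Prop :=
  hom2 [:: a; b] [:: c] t /\ universal_out 0 t.

Definition tensor_unit (X : polybicat) (x : cell0 X) (e : cell1 X) : Prop :=
  [/\ hom1 x x e,
      forall (y : cell0 X) (a : cell1 X), hom1 x y a ->
        exists l : cell2 X,
          [/\ hom2 [:: e; a] [:: a] l, universal_out 0 l & universal_in 1 l] &
      forall (z : cell0 X) (b : cell1 X), hom1 z x b ->
        exists r : cell2 X,
          [/\ hom2 [:: b; e] [:: b] r, universal_out 0 r & universal_in 0 r]].

Definition tensor_left_universal (X : polybicat) (e : cell1 X) : Prop :=
  (forall (y : cell0 X) (a : cell1 X), hom1 (src e) y a ->
     exists (u : cell1 X) (t : cell2 X),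
       [/\ hom1 (tgt e) y u, hom2 [:: e; u] [:: a] t,
           universal_out 0 t & universal_in 1 t]) /\
  (forall (y : cell0 X) (a' : cell1 X), hom1 (tgt e) y a' ->
     exists (v : cell1 X) (t : cell2 X),
       [/\ hom1 (src e) y v, hom2 [:: e; a'] [:: v] t,
           universal_out 0 t & universal_in 1 t]).

Definition tensor_right_universal (X : polybicat) (e : cell1 X) : Prop :=
  (forall (z : cell0 X) (b' : cell1 X), hom1 z (tgt e) b' ->
     exists (u : cell1 X) (t : cell2 X),
       [/\ hom1 z (src e) u, hom2 [:: u; e] [:: b'] t,
           universal_out 0 t & universal_in 0 t]) /\
  (forall (z : cell0 X) (b : cell1 X), hom1 z (src e) b ->
     exists (v : cell1 X) (t : cell2 X),
       [/\ hom1 z (tgt e) v, hom2 [:: b; e] [:: v] t,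
           universal_out 0 t & universal_in 0 t]).

Definition tensor_universal (X : polybicat) (e : cell1 X) : Prop :=
  tensor_left_universal e /\ tensor_right_universal e.

Definition tensor_strong (X Y : polybicat) (f : morphism X Y) : Prop :=
  [/\ unital_morphism f,
      forall e : cell1 X, tensor_universal e -> tensor_universal (map1 f e) &
      forall (a b c : cell1 X) (t : cell2 X), is_tensor a b c t ->
        is_tensor (map1 f a) (map1 f b) (map1 f c) (map2 f t)].

(* Main.v *)
Require Import Defs.
From mathcomp Require Import all_boot.

(** A tensor unit e on x is tensor universal, because its unitor cells are
    themselves the witnesses, and its unitor (e, e) -> (e) is a tensor.
    Therefore the image E of e is a tensor universal 1-cell with a tensor
    (E, E) -> (E), and such a 1-cell is always a tensor unit: if A is a 1-cell
    starting where E does, then tensor universality gives a U with A a tensor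
    of E and U, so that
      E (x) A  ~  E (x) (E (x) U)  ~  (E (x) E) (x) U  ~  E (x) U  ~  A.
    In terms of cells, let t : (E, U) -> (A) and w : (E, A) -> (V) be the cells
    given by tensor universality, and let m : (E, E) -> (E) be the tensor.
    Cutting m with t and cutting t with w gives two cells with input (E, E, U)
    and outputs (A) and (V), both universal at their output
    ([universal_out_cut]).  Two such cells have isomorphic outputs
    ([universal_out_iso]), and this is where units are needed.  The cell w is
    universal at its output and at its input A; cutting it with the isomorphism
    from V to A preserves both properties ([universal_cut_iso]) and turns it
    into the required unitor (E, A) -> (A).  The other side is symmetric. *)

Set Implicit Arguments.
Unset Strict Implicit.
Unset Printing Implicit Defensive.

Section Polybicat.

Variable X : polybicat.
Implicit Types (a b c e : cell1 X) (G D : seq (cell1 X)) (t s r : cell2 X).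

(** * Cuts along a single output or a single input *)

Lemma cuttable_out1 t s a G1 G2 :
  outp t = [:: a] -> inp s = G1 ++ a :: G2 -> cuttable 0 (size G1) t s.
Proof.
by move=> Ht Hs; exists [::], [::], G1, G2, a; split=> //; split; right.
Qed.

Lemma cuttable_in1 t s a D1 D2 :
  outp t = D1 ++ a :: D2 -> inp s = [:: a] -> cuttable (size D1) 0 t s.
Proof.
by move=> Ht Hs; exists D1, D2, [::], [::], a; split=> //; split; left.
Qed.

Lemma cut_out1 t s a G1 G2 :
  outp t = [:: a] -> inp s = G1 ++ a :: G2 ->
  hom2 (G1 ++ inp t ++ G2) (outp s) (cut 0 (size G1) t s).
Proof.
move=> Ht Hs.
have /= := @cut_boundary X t s [::] [::] G1 G2 a Ht Hs.
by rewrite cats0; apply; split; right.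
Qed.

Lemma cut_in1 t s a D1 D2 :
  outp t = D1 ++ a :: D2 -> inp s = [:: a] ->
  hom2 (inp t) (D1 ++ outp s ++ D2) (cut (size D1) 0 t s).
Proof.
move=> Ht Hs.
have /= := @cut_boundary X t s D1 D2 [::] [::] a Ht Hs.
by rewrite cats0; apply; split; left.
Qed.

(** * Universality at a single output *)

(** With a single output the planarity condition is vacuous, and universality
    is plain unique factorization. *)
Lemma universal_out1P t a : outp t = [:: a] ->
  universal_out 0 t <->
  (forall G1 G2 D s, D <> [::] -> hom2 (G1 ++ inp t ++ G2) D s ->
     exists! r, hom2 (G1 ++ a :: G2) D r /\ s = cut 0 (size G1) t r).
Proof.
move=> Ht; split=> [[D1 [D2 [a' [E /size0nil D1E U]]]]|U].
  move: E U; rewrite D1E Ht /= => -[<- <-] U G1 G2 D s D0 Hs.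
  by apply: U; rewrite ?cats0 //; split; right.
exists [::], [::], a; split=> // G1 G2 D s D0 _ /=; rewrite cats0.
exact: U.
Qed.

Lemma cut_out1_assoc t s r a b G1 G2 D1 D2 :
  outp t = [:: a] -> inp s = G1 ++ a :: G2 ->
  outp s = [:: b] -> inp r = D1 ++ b :: D2 ->
  cut 0 (size D1 + size G1) t (cut 0 (size D1) s r) =
  cut 0 (size D1) (cut 0 (size G1) t s) r.
Proof.
move=> Ht Hsi Hso Hr.
have [_ Eo] := cut_out1 Ht Hsi; have [Ei _] := cut_out1 Hso Hr.
apply: (@cut_chain X t s r 0 (size G1) 0 (size D1)).
- exact: cuttable_out1 Ht Hsi.
- by apply: (@cuttable_out1 _ _ b D1 D2); rewrite // Eo.
- exact: cuttable_out1 Hso Hr.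
- rewrite -size_cat; apply: (@cuttable_out1 _ _ a _ (G2 ++ D2)) => //.
  by rewrite Ei Hsi -!catA.
Qed.

(** Factoring through the composite is factoring first through [t], then
    through [s]. *)
Lemma universal_out_cut t s a b G1 G2 :
  outp t = [:: a] -> inp s = G1 ++ a :: G2 -> outp s = [:: b] ->
  universal_out 0 t -> universal_out 0 s ->
  universal_out 0 (cut 0 (size G1) t s).
Proof.
move=> Ht Hsi Hso /(universal_out1P Ht) Ut /(universal_out1P Hso) Us.
have [Ei Eo] := cut_out1 Ht Hsi.
have Ho : outp (cut 0 (size G1) t s) = [:: b] by rewrite Eo.
apply/(universal_out1P Ho) => D1 D2 D q D0; rewrite Ei => -[Hqi Hqo].
have Hqt : hom2 ((D1 ++ G1) ++ inp t ++ G2 ++ D2) D q.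
  by split; rewrite // Hqi -!catA.
have [q' [[[Hqi' Hqo'] Eq] Uq']] := Ut _ _ _ _ D0 Hqt.
have Hqs : hom2 (D1 ++ inp s ++ D2) D q'.
  by split; rewrite // Hqi' Hsi -!catA.
have [r [[[Hri Hro] Er] Ur]] := Us _ _ _ _ D0 Hqs.
exists r; split=> [|r' [[Hri' Hro'] Er']].
  split; first by split.
  by rewrite -(cut_out1_assoc Ht Hsi Hso Hri) -Er Eq size_cat.
apply: Ur; split; first by split.
have [Ei' Eo'] := cut_out1 Hso Hri'.
apply: Uq'; split.
  by split; rewrite ?Eo' // Ei' Hsi -!catA.
by rewrite size_cat (cut_out1_assoc Ht Hsi Hso Hri').
Qed.

(** * Isomorphisms of 1-cells *)

Definition inverse_cells a b (u v : cell2 X) : Prop :=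
  [/\ hom2 [:: a] [:: b] u, hom2 [:: b] [:: a] v,
      is_unit a (cut 0 0 u v) & is_unit b (cut 0 0 v u)].

(** An endomorphism through which a universal cell factors trivially must be
    the unit, by uniqueness of the factorization. *)
Lemma universal_out_unit p q a b u v (hX : unital X) :
  universal_out 0 p -> outp p = [:: a] ->
  hom2 [:: a] [:: b] u -> hom2 [:: b] [:: a] v ->
  q = cut 0 0 p u -> p = cut 0 0 q v -> is_unit a (cut 0 0 u v).
Proof.
move=> Up Hp [Hui Huo] [Hvi Hvo] Eq Ep.
have [w Hw] := hX a; have [[Hwi Hwo] Wr Wl] := Hw.
have Hpp : hom2 ([::] ++ inp p ++ [::]) [:: a] p by rewrite cats0.
have aneq : [:: a] <> [::] by [].
have [r [_ Ur]] := (universal_out1P Hp).1 Up [::] [::] [:: a] p aneq Hpp.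
have <- : w = cut 0 0 u v; last by [].
rewrite -(Ur w) ?(Ur (cut 0 0 u v)) //; split=> //=.
- have [E1 E2] := @cut_out1 u v b [::] [::] Huo Hvi.
  by split; rewrite ?E1 ?E2 ?Hui ?Hvo.
- rewrite (@cut_out1_assoc p u v a b [::] [::] [::] [::]) //=.
  by rewrite -Eq -Ep.
- by rewrite Wr //; apply: (@cuttable_out1 _ _ a [::] [::]).
Qed.

Lemma universal_out_iso p q a b (hX : unital X) :
  universal_out 0 p -> universal_out 0 q -> inp p = inp q ->
  outp p = [:: a] -> outp q = [:: b] ->
  exists u v, inverse_cells a b u v.
Proof.
move=> Up Uq Epq Hp Hq.
have Hqp : hom2 ([::] ++ inp p ++ [::]) [:: b] q by rewrite cats0.
have Hpq : hom2 ([::] ++ inp q ++ [::]) [:: a] p by rewrite cats0.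
have bneq : [:: b] <> [::] by [].
have aneq : [:: a] <> [::] by [].
have [u [[Hu Eu] _]] := (universal_out1P Hp).1 Up _ _ _ _ bneq Hqp.
have [v [[Hv Ev] _]] := (universal_out1P Hq).1 Uq _ _ _ _ aneq Hpq.
exists u, v; split=> //.
- exact: (universal_out_unit hX Up Hp Hu Hv Eu Ev).
- exact: (universal_out_unit hX Uq Hq Hv Hu Ev Eu).
Qed.

(** The factor of s through [u] is the cut of [v] with s. *)
Lemma universal_out_inverse a b u v : inverse_cells a b u v ->
  universal_out 0 u.
Proof.
move=> [[Hui Huo] [Hvi Hvo] [_ _ Wuv] [_ _ Wvu]].
have [vu_i vu_o] := @cut_out1 v u a [::] [::] Hvo Hui.
have [uv_i uv_o] := @cut_out1 u v b [::] [::] Huo Hvi.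
apply/(universal_out1P Huo) => G1 G2 D s _ []; rewrite Hui => Hsi Hso.
have [Ei Eo] := cut_out1 Hvo Hsi.
exists (cut 0 (size G1) v s); split=> [|r [[Hri Hro] Es]].
  split; first by split; rewrite ?Ei ?Eo ?Hvi.
  have := @cut_out1_assoc u v s b a [::] [::] G1 G2 Huo Hvi Hvo Hsi.
  rewrite /= addn0 => ->; rewrite Wuv //.
  by apply: (@cuttable_out1 _ _ a G1 G2); rewrite // uv_o.
have := @cut_out1_assoc v u r a b [::] [::] G1 G2 Hvo Hui Huo Hri.
rewrite /= addn0 -Es => ->; rewrite Wvu //.
by apply: (@cuttable_out1 _ _ b G1 G2); rewrite // vu_o.
Qed.

Lemma cut_in1_assoc t s r a b D1 D2 G1 G2 :
  planar G1 G2 D1 D2 ->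
  outp t = D1 ++ a :: D2 -> inp s = G1 ++ a :: G2 ->
  outp s = [:: b] -> inp r = [:: b] ->
  cut (size D1) (size G1) t (cut 0 0 s r) =
  cut (size D1) 0 (cut (size D1) (size G1) t s) r.
Proof.
move=> P Ht Hsi Hso Hr.
have [_ Eo] := cut_boundary Ht Hsi P.
have [Ei _] := @cut_in1 s r b [::] [::] Hso Hr.
have := @cut_chain X t s r (size D1) (size G1) 0 0; rewrite addn0; apply.
- by exists D1, D2, G1, G2, a.
- by apply: (@cuttable_in1 _ _ b D1 D2); rewrite // Eo Hso.
- exact: (@cuttable_in1 _ _ b [::] [::]).
- by exists D1, D2, G1, G2, a; split; rewrite // Ei.
Qed.

(** Since [v] undoes [u], factoring s through the composite amounts, by
    associativity, to factoring the cut of s with [v] through [t]. *)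
Lemma universal_in_cut_iso i t b c u v :
  outp t = [:: b] -> inverse_cells b c u v ->
  universal_in i t -> universal_in i (cut 0 0 t u).
Proof.
move=> Ht [[Hui Huo] [Hvi Hvo] [[uv_i uv_o] Wuv _] [[vu_i vu_o] Wvu _]].
move=> [G1 [G2 [a [Hti <- U]]]].
have [Ei Eo] := @cut_in1 t u b [::] [::] Ht Hui.
exists G1, G2, a; split=> [||D1 D2 G s G0 P]; rewrite ?Ei // Eo Huo.
case=> Hsi Hso; rewrite /= in Hso.
have nilP : planar [::] [::] D1 D2 by split; left.
have [Ei' Eo'] := @cut_in1 s v c D1 D2 Hso Hvi.
have Hs' : hom2 (G1 ++ G ++ G2) (D1 ++ outp t ++ D2) (cut (size D1) 0 s v).
  by split; rewrite ?Ei' ?Eo' ?Hvo ?Ht.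
have [r [[[Hri Hro] Er] Ur]] := U _ _ _ _ G0 P Hs'.
exists r; split=> [|r' [[Hri' Hro'] Er']].
  split; first by split.
  rewrite (cut_in1_assoc P Hro Hti Ht Hui) -Er.
  rewrite -(@cut_in1_assoc s v u c b D1 D2 [::] [::]) // Wvu //.
  by apply: (@cuttable_in1 _ _ c D1 D2).
have [_ Eo2] := cut_boundary Hro' Hti P.
apply: Ur; split; first by split.
rewrite Er' (cut_in1_assoc P Hro' Hti Ht Hui).
rewrite -(@cut_in1_assoc _ u v b c D1 D2 [::] [::]) ?Eo2 ?Ht // Wuv //.
by apply: (@cuttable_in1 _ _ b D1 D2); rewrite // Eo2 Ht.
Qed.

Lemma universal_cut_iso i G t b c u v :
  hom2 G [:: b] t -> inverse_cells b c u v ->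
  universal_out 0 t -> universal_in i t ->
  exists l, [/\ hom2 G [:: c] l, universal_out 0 l & universal_in i l].
Proof.
move=> [Hti Hto] uvI Uo Ui; have [[Hui Huo] _ _ _] := uvI.
exists (cut 0 0 t u); split; last exact: universal_in_cut_iso Hto uvI Ui.
- have [Ei Eo] := @cut_in1 t u b [::] [::] Hto Hui.
  by split; rewrite ?Ei ?Eo ?Huo.
- apply: (@universal_out_cut t u b c [::] [::]) => //.
  exact: universal_out_inverse uvI.
Qed.

(** * Tensor units and tensor universality *)

Lemma tensor_unit_universal x e : tensor_unit x e -> tensor_universal e.
Proof.
move=> [[Hs Ht] L R]; split; split; rewrite ?Hs ?Ht => y a Ha.
- by have [l [? ? ?]] := L y a Ha; exists a, l.
- by have [l [? ? ?]] := L y a Ha; exists a, l.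
- by have [r [? ? ?]] := R y a Ha; exists a, r.
- by have [r [? ? ?]] := R y a Ha; exists a, r.
Qed.

(** An idempotent that is invertible for the tensor is a unit: every [a] has the
    form e (x) u, on which tensoring once more with [e] has no effect. The
    unitor so obtained is an isomorphic copy of a cell given by tensor
    universality, from which it inherits universality at its input. *)
Lemma tensor_unit_of_idempotent x e m (hX : unital X) :
  hom1 x x e -> tensor_universal e -> is_tensor e e e m -> tensor_unit x e.
Proof.
move=> Hxe [[L1 L2] [R1 R2]] [[Hmi Hmo] Um].
have [Hs Ht] := Hxe; rewrite Hs in L1 L2 R1 R2; rewrite Ht in L1 L2 R1 R2.
split=> // y a Ha.
  have [u [t [Hu [Hti Hto] Ut _]]] := L1 y a Ha.
  have [w [q [_ [Hqi Hqo] Uq Uqi]]] := L2 y a Ha.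
  have [Ei1 Eo1] := @cut_out1 t q a [:: e] [::] Hto Hqi.
  have [Ei2 Eo2] := @cut_out1 m t e [::] [:: u] Hmo Hti.
  have U1 := @universal_out_cut t q a w [:: e] [::] Hto Hqi Hqo Ut Uq.
  have U2 := @universal_out_cut m t e a [::] [:: u] Hmo Hti Hto Um Ut.
  have [i [i' I]] : exists i i', inverse_cells w a i i'.
    apply: (universal_out_iso hX U1 U2); rewrite ?Eo1 ?Eo2 //.
    by rewrite Ei1 Ei2 Hti Hmi.
  exact: universal_cut_iso (conj Hqi Hqo) I Uq Uqi.
have [u [t [Hu [Hti Hto] Ut _]]] := R1 y a Ha.
have [w [q [_ [Hqi Hqo] Uq Uqi]]] := R2 y a Ha.
have [Ei1 Eo1] := @cut_out1 t q a [::] [:: e] Hto Hqi.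
have [Ei2 Eo2] := @cut_out1 m t e [:: u] [::] Hmo Hti.
have U1 := @universal_out_cut t q a w [::] [:: e] Hto Hqi Hqo Ut Uq.
have U2 := @universal_out_cut m t e a [:: u] [::] Hmo Hti Hto Um Ut.
have [i [i' I]] : exists i i', inverse_cells w a i i'.
  apply: (universal_out_iso hX U1 U2); rewrite ?Eo1 ?Eo2 //.
  by rewrite Ei1 Ei2 Hti Hmi.
exact: universal_cut_iso (conj Hqi Hqo) I Uq Uqi.
Qed.

End Polybicat.

Theorem proposition3p15 (X Y : polybicat) (hX : unital X) (hY : unital Y)
    (f : morphism X Y) (hf : tensor_strong f) (x : cell0 X) (e : cell1 X)
    (he : tensor_unit x e) :
  tensor_unit (map0 f x) (map1 f e).
Proof.
have [_ fU fT] := hf; have [Hxe L _] := he.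
have [m [Hm Um _]] := L x e Hxe.
apply: (tensor_unit_of_idempotent hY _ (fU e (tensor_unit_universal he))).
  by case: Hxe => Hs Ht; split; rewrite ?map_src ?map_tgt ?Hs ?Ht.
exact: fT _ _ _ m (conj Hm Um).
Qed.
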